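(* Let $d,l\ge 1$ be integers, let $n_1,\dots,n_d$ be positive integers, and let $M\subset\mathcal{P}([d])$ be non-empty. Let $E$ be the set of points of $[n_1]\times\dots\times[n_d]$ whose coordinates are not all pairwise distinct. If $A\subset[n_1]\times\dots\times[n_d]$ satisfies $\mathrm{c}_M(A\setminus E)\ge d^d|M|\,l$, then there exist pairwise disjoint sets $X_1\subset[n_1],\dots,X_d\subset[n_d]$ such that \[\mathrm{c}_M\big(A\cap(X_1\times\dots\times X_d)\big)\ge l.\]
   Context: $[k]=\{1,\dots,k\}$. For $B \subset [d]$, a $B$-subspace is a maximal subset $S$ of $[n_1]\times\dots\times[n_d]$ such that $x_i = y_i$ whenever $x,y\in S$ and $i \notin B$. For non-empty $M\subset\mathcal{P}([d])$, an $M$-subspace is a $B$-subspace for some $B\in M$. The $M$-covering number $\mathrm{c}_M(A)$ of $A\subset[n_1]\times\dots\times[n_d]$ is the smallest nonnegative integer $k$ such that $A$ is contained in a union of $k$ $M$-subspaces. *)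

(* Defs.v *)
From mathcomp Require Import all_boot.

Set Implicit Arguments.
Unset Strict Implicit.
Unset Printing Implicit Defensive.

(* The interval [k] = {1, ..., k} is represented by 'I_k = {0, ..., k - 1}: every
   coordinate is shifted by one, so coordinates taken from different factors are
   compared through their values in nat. *)
Definition grid (d : nat) (n : 'I_d -> nat) : finType :=
  {dffun forall i : 'I_d, 'I_(n i)}.

Section Covering.

Variables (d : nat) (n : 'I_d -> nat).
Implicit Types (x y : grid n) (A S : {set grid n}).
Implicit Types (B : {set 'I_d}) (M : {set {set 'I_d}}).

Definition constant_off B S : bool :=
  [forall x in S, forall y in S, forall i : 'I_d, (i \notin B) ==> (x i == y i)].

Definition is_subspace B S : bool := maxset (constant_off B) S.

Definition is_Msubspace M S : bool := [exists B in M, is_subspace B S].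

Definition coverable M A (k : nat) : bool :=
  [exists t : k.-tuple {set grid n},
    all (is_Msubspace M) t && (A \subset \bigcup_(S <- t) S)].

Lemma coverable_ex M A : M != set0 -> exists k, coverable M A k.
Proof.
case/set0Pn=> B BM.
have sub1 x : {S | is_subspace B S & [set x] \subset S}.
  apply: maxset_exists; apply/forall_inP=> y /set1P->.
  by apply/forall_inP=> z /set1P->; apply/forallP=> i; rewrite eqxx implybT.
pose F x := s2val (sub1 x).
exists (size (map F (enum A))); apply/existsP; exists (in_tuple (map F (enum A))).
apply/andP; split.
  apply/allP=> S /mapP[x _ ->]; apply/existsP; exists B; rewrite BM.
  exact: (s2valP (sub1 x)).
apply/subsetP=> x xA; rewrite /= big_map big_enum; apply/bigcupP; exists x => //.
by have /subsetP-> := s2valP' (sub1 x); rewrite ?set11.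
Qed.

(* Coverability by some k is guaranteed only when M is non-empty, hence the
   proof argument. *)
Definition covering_number M (M0 : M != set0) A : nat :=
  ex_minn (coverable_ex A M0).

Definition repeated_coords : {set grid n} :=
  [set x : grid n | [exists i, exists j, (i != j) && (x i == x j :> nat)]].

End Covering.

Definition pairwise_disjoint (d : nat) (n : 'I_d -> nat)
    (X : forall i : 'I_d, {set 'I_(n i)}) : Prop :=
  forall (i j : 'I_d) (a : 'I_(n i)) (b : 'I_(n j)),
    i != j -> a \in X i -> b \in X j -> a <> b :> nat.

(* Main.v *)
Require Import Defs.
From mathcomp Require Import all_boot.

(** Colour the values of the coordinates with [d] colours and let [X_i] be the
values of colour [i]. A point with distinct coordinates lies in
[X_1 * ... * X_d] for a proportion [d ^ -d] of all colourings. If every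
colouring admitted a cover by fewer than [l] subspaces, these covers, averaged
over the colourings and multiplied by [d ^ d], would form a fractional cover of
[A \ E] of weight less than [d ^ d * l]. A point lies on at most [#|M|]
[M]-subspaces, so those of weight at least [1 / #|M|] already cover [A \ E],
and there are fewer than [d ^ d * #|M| * l] of them. *)

Set Implicit Arguments.
Unset Strict Implicit.
Unset Printing Implicit Defensive.

(** The constraints fix the values at [#|I|] distinct points and leave the others free. The product
    form avoids subtraction in the exponent. *)
Lemma card_extensions (I V T : finType) (f : I -> V) (g : I -> T) :
  injective f ->
  #|[set c : {ffun V -> T} | [forall i, c (f i) == g i]]| * #|T| ^ #|I|
    = #|T| ^ #|V|.
Proof.
move=> f_inj.
(* [F v] holds the values allowed at [v], so the count becomes a product over [v], with factor 1 on
   the image of [f] and [#|T|] elsewhere. *)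
pose F v : pred T := if [pick i | f i == v] is Some i then pred1 (g i) else predT.
have -> : #|[set c : {ffun V -> T} | [forall i, c (f i) == g i]]| = #|family F|.
  rewrite cardsE; apply: eq_card => c; rewrite unfold_in /=.
  apply/forallP/familyP => [cP v | cP i]; rewrite ?inE.
    by rewrite /F; case: pickP => // i /eqP <-; rewrite inE cP.
  have := cP (f i); rewrite /F; case: pickP => [j /eqP/f_inj -> // |].
  by move/(_ i); rewrite eqxx.
rewrite card_family foldrE big_map big_enum /=.
rewrite (bigID (mem (codom f))) /= big1 ?mul1n; last first.
  move=> v /codomP[i ->]; rewrite /F; case: pickP => [j _|]; first exact: card1.
  by move/(_ i); rewrite eqxx.
rewrite (eq_bigr (fun=> #|T|)); last first.
  move=> v vNf; rewrite /F; case: pickP => [i /eqP fi | _]; last by [].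
  by rewrite -fi codom_f in vNf.
rewrite prod_nat_const -expnD -(card_codom f_inj) addnC.
by rewrite -(cardC (mem (codom f))); congr (_ ^ (_ + _)).
Qed.

Section Covering.

Variables (d : nat) (n : 'I_d -> nat).
Implicit Types (x : grid n) (A S : {set grid n}).
Implicit Types (B : {set 'I_d}) (M : {set {set 'I_d}}).

Definition cylinder B x : {set grid n} :=
  [set y : grid n | [forall i, (i \notin B) ==> (y i == x i)]].

Lemma subspace_cylinder B S x : is_subspace B S -> x \in S -> S = cylinder B x.
Proof.
case/maxsetP=> /forall_inP constS maxS xS; symmetry; apply: maxS.
  apply/forall_inP=> y; rewrite inE => /forallP yP.
  apply/forall_inP=> z; rewrite inE => /forallP zP.
  apply/forallP=> i; apply/implyP=> iB.
  by rewrite (eqP (implyP (yP i) iB)) (eqP (implyP (zP i) iB)).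
apply/subsetP=> y yS; rewrite inE; apply/forallP=> i.
by have /forall_inP/(_ x xS)/forallP := constS y yS.
Qed.

(** Each [B] in [M] yields only one [B]-subspace through [x], its cylinder. *)
Lemma card_Msubspaces_through M x :
  #|[set S | is_Msubspace M S & x \in S]| <= #|M|.
Proof.
apply: leq_trans (leq_imset_card (cylinder^~ x) (mem M)).
apply/subset_leq_card/subsetP=> S; rewrite inE => /andP[/exists_inP[B BM BS] xS].
by apply/imsetP; exists B => //; apply: subspace_cylinder.
Qed.

Lemma covering_number_min M (M0 : M != set0) A (G : {set {set grid n}}) :
  {in G, forall S, is_Msubspace M S} ->
  {in A, forall x, exists2 S, S \in G & x \in S} ->
  covering_number M0 A <= #|G|.
Proof.
move=> GM GA; rewrite /covering_number; case: ex_minnP => k _; apply.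
apply/existsP; exists (Tuple (introT eqP (esym (cardE G)))); apply/andP; split.
  by apply/allP=> S /=; rewrite mem_enum => /GM.
apply/subsetP=> x /GA[S SG xS]; rewrite /= big_enum.
by apply/bigcupP; exists S.
Qed.

Lemma covering_number_cover M (M0 : M != set0) A :
  exists G : {set {set grid n}},
    [/\ #|G| <= covering_number M0 A, {in G, forall S, is_Msubspace M S} &
        {in A, forall x, exists2 S, S \in G & x \in S}].
Proof.
rewrite /covering_number; case: ex_minnP => k /existsP[t /andP[/allP tM /subsetP tA]] _.
exists [set S in tval t]; split=> [|S|x /tA].
- by rewrite cardsE -[leqRHS](size_tuple t) card_size.
- by rewrite inE => /tM.
elim: (tval t) => [|S s IHs]; first by rewrite big_nil inE.
rewrite big_cons inE => /orP[xS | /IHs[S' S's xS']].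
  by exists S; rewrite // !inE eqxx.
by exists S' => //; rewrite !inE in S's *; rewrite S's orbT.
Qed.

(* The hypotheses say that [C], averaged and scaled by [r], is a fractional
   cover of [A]. *)
Lemma covering_number_rounding M (M0 : M != set0) A (I : finType)
    (C : I -> {set {set grid n}}) (r k : nat) :
  0 < #|I| ->
  (forall c, {in C c, forall S, is_Msubspace M S}) ->
  (forall c, #|C c| <= k) ->
  {in A, forall x, #|I| <= #|[set c | [exists S in C c, x \in S]]| * r} ->
  covering_number M0 A <= r * #|M| * k.
Proof.
move=> I_gt0 CM Ck CA.
pose w S := #|[set c | S \in C c]|.
(* The fractional weight of [S] is [w S * r / #|I|]; [G] keeps the subspaces of weight at least
   [1 / #|M|]. *)
pose G := [set S | is_Msubspace M S & #|I| <= w S * (r * #|M|)].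
apply: (@leq_trans #|G|).
  apply: covering_number_min => [S|x xA]; first by rewrite inE => /andP[].
  have M_gt0 : 0 < #|M| by rewrite card_gt0.
  apply/exists_inP; apply: contraT; rewrite negb_exists_in => /forall_inP noG.
  pose P S := is_Msubspace M S && (x \in S).
  have wP S : P S -> w S * (r * #|M|) < #|I|.
    case/andP=> MS xS; rewrite ltnNge; apply/negP=> wS.
    by have := noG S; rewrite inE MS wS xS => /(_ isT).
  (* Union bound over the [M]-subspaces through [x]. *)
  have cov : #|[set c | [exists S in C c, x \in S]]| <= \sum_(S | P S) w S.
    rewrite -sum1_card (eq_bigr (fun S => \sum_c (S \in C c)%N)); last first.
      by move=> S _; rewrite /w -sum1dep_card big_mkcond.
    rewrite exchange_big big_mkcond /=; apply: leq_sum => c _.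
    rewrite inE; case: exists_inP => // -[S SC xS].
    by rewrite (bigD1 S) /= ?SC // /P xS (CM c).
  have big : #|I| * #|M| <= \sum_(S | P S) w S * (r * #|M|).
    rewrite -big_distrl /= mulnA leq_mul2r (leq_trans (CA x xA)) ?orbT //.
    by rewrite leq_mul2r cov orbT.
  (* The successor records that each term is strictly below [#|I|]. A single [S] through [x] then
     contradicts [big]; if there is none, [big] bounds a positive number by 0. *)
  have small : \sum_(S | P S) (w S * (r * #|M|)).+1 <= #|I| * #|M|.
    apply: (@leq_trans (\sum_(S | P S) #|I|)); first exact: leq_sum.
    rewrite sum_nat_const mulnC leq_mul2l; apply/orP; right.
    by rewrite (leq_trans _ (card_Msubspaces_through M x)) // cardsE.
  have [S PS | P0] := pickP P; last first.
    by move: big; rewrite big_pred0 // leqn0 muln_eq0 !gtn_eqF.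
  have := leq_trans small big; rewrite (bigD1 S) //= [leqRHS](bigD1 S) //=.
  rewrite addSn ltnNge leq_add2l => /negP[]; exact: leq_sum.
(* Double counting: the sum of all [w S] is the sum of all [#|C c|], at most [#|I| * k]. *)
rewrite -(leq_pmul2l I_gt0) mulnC -sum_nat_const.
apply: (@leq_trans (\sum_S w S * (r * #|M|))).
  by rewrite big_mkcond; apply: leq_sum => S _; case: ifP => //; rewrite inE => /andP[].
rewrite -big_distrl /= mulnC mulnCA leq_mul2l; apply/orP; right.
rewrite (eq_bigr (fun S => \sum_c (S \in C c)%N)); last first.
  by move=> S _; rewrite /w -sum1dep_card big_mkcond.
rewrite exchange_big /= -sum_nat_const; apply: leq_sum => c _.
by apply: leq_trans (Ck c); rewrite -sum1_card [leqRHS]big_mkcond.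
Qed.

(** All factors share one set of values, so that equal values in different factors get the same
    colour. *)
Definition embed_value (i : 'I_d) : 'I_(n i) -> 'I_(\max_i n i) :=
  widen_ord (leq_bigmax i).

Definition color_classes (c : {ffun 'I_(\max_i n i) -> 'I_d}) (i : 'I_d) :
  {set 'I_(n i)} := [set a | c (embed_value a) == i].

Lemma color_classes_disjoint c : pairwise_disjoint (color_classes c).
Proof.
move=> i j a b ij; rewrite !inE => /eqP ca /eqP cb ab; case/eqP: ij.
by rewrite -ca -cb; congr (c _); apply: val_inj.
Qed.

(** The [d] coordinates of [x] are distinct values, and the colour of each is prescribed. *)
Lemma card_colorings_through x : x \notin repeated_coords n ->
  #|[set c | x \in setXn (color_classes c)]| * d ^ d = d ^ (\max_i n i).
Proof.
move=> xE; have x_inj : injective (fun i => embed_value (x i)).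
  move=> i j /(congr1 val) /= xij; apply/eqP; apply: contraNT xE => ij.
  by rewrite inE; apply/existsP; exists i; apply/existsP; exists j; rewrite ij xij eqxx.
have := card_extensions id x_inj; rewrite !card_ord => <-.
congr (#|pred_of_set _| * _); apply/setP=> c; rewrite !inE.
by apply: eq_forallb => i; rewrite inE.
Qed.

End Covering.

Theorem theorem2p4 (d l : nat) (n : 'I_d -> nat) (M : {set {set 'I_d}})
    (d_gt0 : 1 <= d) (l_gt0 : 1 <= l) (n_gt0 : forall i, 0 < n i)
    (M0 : M != set0) (A : {set grid n}) :
  d ^ d * #|M| * l <= covering_number M0 (A :\: repeated_coords n) ->
  exists X : forall i : 'I_d, {set 'I_(n i)},
    pairwise_disjoint X /\ l <= covering_number M0 (A :&: setXn X).
Proof.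
move=> large; pose Ac c := A :&: setXn (color_classes (n := n) c).
have [c lc | small] := pickP (fun c => l <= covering_number M0 (Ac c)).
  by exists (color_classes c); split=> //; apply: color_classes_disjoint.
have [C CP] := fin_all_exists (fun c => covering_number_cover M0 (Ac c)).
(* If every colouring fails, each cover has at most [l.-1] members; as [d ^ d * #|M|] is positive,
   this bound contradicts [large]. *)
suff : covering_number M0 (A :\: repeated_coords n) <= d ^ d * #|M| * l.-1.
  move/(leq_trans large); rewrite leq_pmul2l; first by rewrite -ltnS prednK // ltnn.
  by rewrite muln_gt0 expn_gt0 d_gt0 card_gt0.
apply: (@covering_number_rounding _ _ _ M0 _ _ C) => [|c|c|x].
- by rewrite card_ffun !card_ord expn_gt0 d_gt0.
- by case: (CP c).
- case: (CP c) => Cc _ _; apply: leq_trans Cc _.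
  by rewrite -ltnS prednK // ltnNge small.
(* Every colouring whose product contains [x] has a cover that reaches [x], which gives the
   proportion [d ^ -d]. *)
rewrite inE => /andP[xE xA]; rewrite card_ffun !card_ord -(card_colorings_through xE).
rewrite leq_mul2r; apply/orP; right; apply/subset_leq_card/subsetP=> c.
rewrite !in_set => xc; case: (CP c) => _ _ /(_ x) [|S SC xS].
  by rewrite inE xA in_set.
by apply/exists_inP; exists S.
Qed.
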